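(* Let $\Delta$ be a simplicial complex on a finite vertex set $V$ and $R$ a commutative ring with identity. Then the Stanley–Reisner algebra $R[\Delta]$ is isomorphic to the binoid algebra $R[M_\Delta]$ of the binoid $M_\Delta$ associated to $\Delta$.
   Context: A commutative binoid is a commutative monoid $(M,+,0)$ with an absorbing element $\infty$ ($a+\infty=\infty$). The binoid algebra $R[M]$ is the $R$-algebra that is free as an $R$-module on $T^a$, $a\in M\setminus\{\infty\}$, with multiplication $T^aT^b=T^{a+b}$ if $a+b\neq\infty$ and $T^aT^b=0$ otherwise. A simplicial complex on a finite set $V$ is a collection $\Delta$ of subsets of $V$ that is closed under taking subsets and contains $\emptyset$ and all singletons $\{v\}$, $v\in V$. The free commutative binoid on $V$ is $\mathbb N^V\cup\{\infty\}$; its elements $\neq\infty$ are written $f=\sum_{v\in V}n_vv$, with support $\operatorname{supp}(f)=\{v\mid n_v\ne0\}$. The binoid $M_\Delta$ is the quotient of the free commutative binoid on $V$ obtained by identifying with $\infty$ all elements $f$ with $\operatorname{supp}(f)\notin\Delta$ (and nothing else). The Stanley–Reisner algebra is $R[\Delta]=R[X_v\mid v\in V]/\mathfrak I_\Delta$, where $\mathfrak I_\Delta$ is generated by all monomials $\prod_{v\in A}X_v$ with $A\subseteq V$, $A\notin\Delta$. *)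

(* Defs.v *)
From HB Require Import structures.
From mathcomp Require Import all_boot all_algebra.
From mathcomp Require Import finmap.
From mathcomp Require Import boolp.
From mathcomp Require Import monalg.

Set Implicit Arguments.
Unset Strict Implicit.
Unset Printing Implicit Defensive.

Import GRing.Theory.
Local Open Scope ring_scope.
Local Open Scope quotient_scope.

(* nmodType is the library's structure of commutative monoids (N, +, 0). *)
HB.mixin Record Nmodule_isBinoid M of GRing.Nmodule M := {
  binfty : M;
  addr_binfty : forall a : M, a + binfty = binfty
}.

#[short(type="binoidType")]
HB.structure Definition Binoid := {M of GRing.Nmodule M & Nmodule_isBinoid M}.

Arguments binfty {s}.

(* Common proofs of the algebra laws for the product                           *)
(*   (g, h) |-> \sum_(a, b) g_a h_b T^(ab)                                     *)
(* of finitely supported functions on K, where K sits via i in a commutative   *)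
(* monoid N and T^m is zero for m outside an absorbing complement of K.        *)
Section Convolution.
Variables (R : comPzRingType) (K : choiceType).
Variables (N : Type) (e : N) (op : N -> N -> N) (i : K -> N).
Variable T : N -> R -> {malg R[K]}.
Hypothesis opA : associative op.
Hypothesis opC : commutative op.
Hypothesis op1 : left_id e op.
Hypothesis TB : forall m, {morph T m : c d / c - d}.
Hypothesis T_i : forall k c, T (i k) c = << c *g k >>.
Hypothesis T_dich :
  forall m, (exists k, m = i k) \/ (forall n c, T (op m n) c = 0).

Implicit Types (g h : {malg R[K]}).

Definition convolution g h : {malg R[K]} :=
  \sum_(a <- msupp g) \sum_(b <- msupp h) T (op (i a) (i b)) (g@_a * h@_b).

Let T0 m : T m 0 = 0.
Proof. by rewrite -[X in T m X](subrr 0) TB subrr. Qed.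

Let TN m c : T m (- c) = - T m c.
Proof. by rewrite -[- c]add0r TB T0 add0r. Qed.

Let TD m c d : T m (c + d) = T m c + T m d.
Proof. by rewrite -{1}[d]opprK TB TN opprK. Qed.

Lemma convolutionEw (d1 d2 : {fset K}) g h :
  (msupp g `<=` d1)%fset -> (msupp h `<=` d2)%fset ->
  convolution g h =
    \sum_(a <- d1) \sum_(b <- d2) T (op (i a) (i b)) (g@_a * h@_b).
Proof.
move=> le1 le2; rewrite /convolution (big_fset_incl _ le1) /=.
  apply/eq_bigr=> a _; apply/big_fset_incl => // b _ /mcoeff_outdom ->.
  by rewrite mulr0 T0.
by move=> a _ /mcoeff_outdom ga; rewrite big1 => // b _; rewrite ga mul0r T0.
Qed.

Lemma convolutionC : commutative convolution.
Proof.
move=> g h; rewrite /convolution exchange_big /=.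
by apply: eq_bigr => a _; apply: eq_bigr => b _; rewrite opC mulrC.
Qed.

Lemma convolutionDl : left_distributive convolution +%R.
Proof.
move=> g1 g2 h.
pose d := (msupp g1 `|` msupp g2)%fset.
have s1 : (msupp g1 `<=` d)%fset by apply: fsubsetUl.
have s2 : (msupp g2 `<=` d)%fset by apply: fsubsetUr.
rewrite (convolutionEw (msuppD_le _ _) (fsubset_refl _)).
rewrite (convolutionEw s1 (fsubset_refl _)) (convolutionEw s2 (fsubset_refl _)).
rewrite -big_split /=; apply: eq_bigr => a _; rewrite -big_split /=.
by apply: eq_bigr => b _; rewrite mcoeffD mulrDl TD.
Qed.

Lemma convolution0g h : convolution 0 h = 0.
Proof. by rewrite /convolution msupp0 big_seq_fset0. Qed.

Lemma convolution_suml (J : Type) (s : seq J) (F : J -> {malg R[K]}) h :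
  convolution (\sum_(j <- s) F j) h = \sum_(j <- s) convolution (F j) h.
Proof.
elim: s => [|j s IHs]; first by rewrite !big_nil convolution0g.
by rewrite !big_cons convolutionDl IHs.
Qed.

Lemma convolution_sumr (J : Type) (s : seq J) (F : J -> {malg R[K]}) h :
  convolution h (\sum_(j <- s) F j) = \sum_(j <- s) convolution h (F j).
Proof.
by rewrite convolutionC convolution_suml; apply: eq_bigr => j _; rewrite convolutionC.
Qed.

Lemma convolution_Tg m c h :
  convolution (T m c) h = \sum_(b <- msupp h) T (op m (i b)) (c * h@_b).
Proof.
have [[k ->]|T_m] := T_dich m.
  rewrite T_i (convolutionEw msuppU_le (fsubset_refl _)) big_seq_fset1.
  by apply: eq_bigr => b _; rewrite mcoeffUU.
have -> : T m c = 0 by rewrite -[m]op1 opC T_m.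
by rewrite convolution0g big1.
Qed.

Lemma convolutionA : associative convolution.
Proof.
move=> f g h.
have L a b c x y z : convolution (T (i a) x) (convolution (T (i b) y) (T (i c) z))
    = convolution (convolution (T (i a) x) (T (i b) y)) (T (i c) z).
  have TT m n u v : convolution (T m u) (T (i n) v) = T (op m (i n)) (u * v).
    rewrite convolution_Tg T_i msuppU; case: eqP => [->|_].
      by rewrite big_seq_fset0 mulr0 T0.
    by rewrite big_seq_fset1 mcoeffUU.
  by rewrite !TT [LHS]convolutionC TT opC mulrC opA mulrA.
rewrite [f]monalgE !convolution_suml; apply: eq_bigr => a _.
rewrite [g]monalgE !(convolution_suml, convolution_sumr).
apply: eq_bigr => b _; rewrite [h]monalgE !convolution_sumr.
by apply: eq_bigr => c _; rewrite -!T_i L.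
Qed.

Lemma convolution1g : left_id (T e 1) convolution.
Proof.
move=> g; rewrite convolution_Tg [RHS]monalgE.
by apply: eq_bigr => b _; rewrite op1 mul1r T_i.
Qed.

Definition malg_pzscale (c : R) g : {malg R[K]} :=
  [malg k in msupp g => c * g@_k].

Lemma mcoeff_pzscale c g k : (malg_pzscale c g)@_k = c * g@_k.
Proof. by rewrite mcoeffE; case: msuppP; rewrite ?mulr0. Qed.

Lemma malg_pzscaleA c d g :
  malg_pzscale c (malg_pzscale d g) = malg_pzscale (c * d) g.
Proof. by apply/malgP => k; rewrite !mcoeff_pzscale mulrA. Qed.

Lemma malg_pzscale1 : left_id 1 malg_pzscale.
Proof. by move=> g; apply/malgP => k; rewrite mcoeff_pzscale mul1r. Qed.

Lemma malg_pzscaleDr : right_distributive malg_pzscale +%R.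
Proof.
by move=> c g h; apply/malgP => k; rewrite mcoeffD !mcoeff_pzscale mcoeffD mulrDr.
Qed.

Lemma malg_pzscaleDl g : {morph malg_pzscale^~ g : c d / c + d}.
Proof.
by move=> c d; apply/malgP => k; rewrite mcoeffD !mcoeff_pzscale mulrDl.
Qed.

Lemma malg_pzscaleE c g : malg_pzscale c g = convolution (T e c) g.
Proof.
have le : (msupp (malg_pzscale c g) `<=` msupp g)%fset.
  apply/fsubsetP=> k; rewrite -!mcoeff_neq0 mcoeff_pzscale.
  by apply: contraNneq => ->; rewrite mulr0.
rewrite convolution_Tg (monalgEw le).
by apply: eq_bigr => b _; rewrite op1 T_i mcoeff_pzscale.
Qed.

Lemma malg_pzscaleAl c g h :
  malg_pzscale c (convolution g h) = convolution (malg_pzscale c g) h.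
Proof. by rewrite !malg_pzscaleE convolutionA. Qed.

End Convolution.

(* The library's ring and algebra structures on {malg R[K]} and its quotients  *)
(* by ideals require 1 != 0 in R.  The instances below, on fresh aliases of    *)
(* the same types and with the same operations, also cover the zero ring.      *)
(* As algType and {lrmorphism _ -> _} have the same restriction, an R-algebra  *)
(* is here a ring and an R-module satisfying the *scalerAl law.                *)

(* {malg R[K]} is the type of finitely supported functions K -> R, with        *)
(* << c *g k >> the function of value c at k and 0 elsewhere.                  *)
Section BinoidAlgebra.
Variables (R : comPzRingType) (M : binoidType).

Definition binoid_algebra : Type := {malg R[{a : M | a != binfty}]}.
HB.instance Definition _ := GRing.Zmodule.on binoid_algebra.

Implicit Types (x y : binoid_algebra) (a : M) (c : R).

(* c T^a, where T^infty = 0 *)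
Definition bterm a c : binoid_algebra :=
  if insub a is Some k then << c *g k >> else 0.

Definition bone : binoid_algebra := bterm 0 1.

Definition bmul x y : binoid_algebra :=
  \sum_(a <- msupp x) \sum_(b <- msupp y)
     bterm (val a + val b) (x@_a * y@_b).

Fact btermB a : {morph bterm a : c d / c - d}.
Proof.
by move=> c d; rewrite /bterm; case: insubP => [k _ _|_]; rewrite ?subr0 ?monalgUB.
Qed.

Fact bterm_val (k : {a : M | a != binfty}) c : bterm (val k) c = << c *g k >>.
Proof. by rewrite /bterm valK. Qed.

Fact bterm_dich a : (exists k : {a : M | a != binfty}, a = val k) \/
  (forall b c, bterm (a + b) c = 0).
Proof.
have [->|an] := eqVneq a binfty; last by left; exists (exist _ a an).
by right=> b c; rewrite addrC addr_binfty /bterm insubF // eqxx.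
Qed.

Fact bmulA : associative bmul.
Proof. exact: (convolutionA (@addrA M) (@addrC M) (@add0r M) btermB bterm_val bterm_dich). Qed.
Fact bmulC : commutative bmul.
Proof. exact: (@convolutionC R _ M +%R val bterm (@addrC M)). Qed.
Fact bmul1 : left_id bone bmul.
Proof. exact: (convolution1g (@addrC M) (@add0r M) btermB bterm_val bterm_dich). Qed.
Fact bmulDl : left_distributive bmul +%R.
Proof. exact: (@convolutionDl R _ M +%R val bterm btermB). Qed.

HB.instance Definition _ :=
  GRing.Zmodule_isComPzRing.Build binoid_algebra bmulA bmulC bmul1 bmulDl.

HB.instance Definition _ := GRing.Zmodule_isLmodule.Build R binoid_algebra
  (@malg_pzscaleA R _) (@malg_pzscale1 R _) (@malg_pzscaleDr R _)
  (@malg_pzscaleDl R _).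

Fact bscalerAl c x y : c *: (x * y) = (c *: x) * y.
Proof.
exact: (malg_pzscaleAl (@addrA M) (@addrC M) (@add0r M) btermB bterm_val bterm_dich).
Qed.

End BinoidAlgebra.

Section PolynomialAlgebra.
Variables (R : comPzRingType) (V : choiceType).

(* {cmonom V} is the library's type of monomials in the variables v : V, which *)
(* are written ucm v; their product is mmul.                                   *)
Definition polynomial_algebra : Type := {malg R[{cmonom V}]}.
HB.instance Definition _ := GRing.Zmodule.on polynomial_algebra.

Implicit Types (p q : polynomial_algebra) (c : R).

Definition pvar (v : V) : polynomial_algebra := << ucm v >>.

Definition pone : polynomial_algebra := << mone >>.

Definition pmul p q : polynomial_algebra :=
  \sum_(m <- msupp p) \sum_(n <- msupp q) << p@_m * q@_n *g mmul m n >>.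

Let U (m : {cmonom V}) (c : R) : {malg R[{cmonom V}]} := << c *g m >>.

Let UB m : {morph U m : c d / c - d}.
Proof. exact: monalgUB. Qed.

Let UE (m : {cmonom V}) c : U (id m) c = << c *g m >>.
Proof. by []. Qed.

Let U_dich (m : {cmonom V}) :
  (exists k : {cmonom V}, m = id k) \/ (forall n c, U (mmul m n) c = 0).
Proof. by left; exists m. Qed.

Fact pmulA : associative pmul.
Proof. exact: (convolutionA (@mulmA _) (@mulmC _) (@mul1m _) UB UE U_dich). Qed.
Fact pmulC : commutative pmul.
Proof. exact: (@convolutionC R _ _ mmul id U (@mulmC _)). Qed.
Fact pmul1 : left_id pone pmul.
Proof. exact: (convolution1g (@mulmC _) (@mul1m _) UB UE U_dich). Qed.
Fact pmulDl : left_distributive pmul +%R.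
Proof. exact: (@convolutionDl R _ _ mmul id U UB). Qed.

HB.instance Definition _ :=
  GRing.Zmodule_isComPzRing.Build polynomial_algebra pmulA pmulC pmul1 pmulDl.

HB.instance Definition _ := GRing.Zmodule_isLmodule.Build R polynomial_algebra
  (@malg_pzscaleA R _) (@malg_pzscale1 R _) (@malg_pzscaleDr R _)
  (@malg_pzscaleDl R _).

Fact pscalerAl c p q : c *: (p * q) = (c *: p) * q.
Proof.
exact: (malg_pzscaleAl (@mulmA _) (@mulmC _) (@mul1m _) UB UE U_dich).
Qed.

End PolynomialAlgebra.

(* Over a nonzero ring the operations agree with the library's. *)
Fact polynomial_algebraE (R : comNzRingType) (V : choiceType)
    (c : R) (p q : {malg R[{cmonom V}]}) :
  [/\ pmul p q = @GRing.mul {malg R[{cmonom V}]} p q,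
      pone R V = @GRing.one {malg R[{cmonom V}]} &
      malg_pzscale c p = @GRing.scale R {malg R[{cmonom V}]} c p].
Proof. by split=> //; apply/malgP => k; rewrite mcoeffZ mcoeff_pzscale. Qed.

Section IdealQuotient.
Variables (A : comPzRingType) (S : A -> Prop).

Definition generated_ideal (x : A) : Prop :=
  exists2 s : seq (A * A), (forall ag, ag \in s -> S ag.2) &
    x = \sum_(ag <- s) ag.1 * ag.2.

Definition generated_idealb : pred A := fun x => `[< generated_ideal x >].

Lemma generated_idealM a x : x \in generated_idealb -> a * x \in generated_idealb.
Proof.
move=> /asboolP[s sS ->]; apply/asboolP.
exists [seq (a * ag.1, ag.2) | ag <- s].
  by move=> _ /mapP[ag ags ->]; exact: (sS ag).
by rewrite big_map mulr_sumr; apply: eq_bigr => ag _; rewrite mulrA.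
Qed.

Fact generated_ideal_zmod_closed : zmod_closed generated_idealb.
Proof.
split=> [|x y xI /(generated_idealM (-1))].
  by apply/asboolP; exists [::] => //; rewrite big_nil.
rewrite mulN1r => /asboolP[t tS ty]; have /asboolP[s sS sx] := xI.
apply/asboolP; exists (s ++ t); last by rewrite big_cat /= -sx -ty.
by move=> ag; rewrite mem_cat => /orP[/sS|/tS].
Qed.

HB.instance Definition _ :=
  GRing.isZmodClosed.Build A generated_idealb generated_ideal_zmod_closed.

Definition ideal_quotient : Type := {ideal_quot (GRing.ZmodClosed.clone A generated_idealb _)}.
HB.instance Definition _ := EqQuotient.on ideal_quotient.
HB.instance Definition _ := GRing.Zmodule.on ideal_quotient.

Local Notation Q := ideal_quotient.

Lemma eq_ideal_quotient (x y : A) :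
  (\pi_Q x == \pi_Q y) = (x - y \in generated_idealb).
Proof. exact/esym/Quotient.idealrBE. Qed.

Fact pi_quotD : {morph \pi_Q : x y / x + y}.
Proof. exact: Quotient.pi_add. Qed.

Definition qone : Q := \pi_Q 1.
Definition qmul := lift_op2 Q *%R.

Fact pi_qmul (x y : A) : qmul (\pi_Q x) (\pi_Q y) = \pi_Q (x * y).
Proof.
unlock qmul; apply/eqP; rewrite eq_ideal_quotient.
have repr_I z : repr (\pi_Q z) - z \in generated_idealb.
  by rewrite -eq_ideal_quotient reprK.
rewrite -[X in X - _](addrNK (repr (\pi_Q x) * y)) -mulrBr -addrA -mulrBl.
by apply: rpredD; [|rewrite mulrC]; apply: generated_idealM.
Qed.

Fact qmulA : associative qmul.
Proof.
by move=> x y z; rewrite -(reprK x) -(reprK y) -(reprK z) !pi_qmul mulrA.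
Qed.
Fact qmulC : commutative qmul.
Proof. by move=> x y; rewrite -(reprK x) -(reprK y) !pi_qmul mulrC. Qed.
Fact qmul1 : left_id qone qmul.
Proof. by move=> x; rewrite -(reprK x) pi_qmul mul1r. Qed.
Fact qmulDl : left_distributive qmul +%R.
Proof.
move=> x y z; rewrite -(reprK x) -(reprK y) -(reprK z).
by rewrite -pi_quotD !pi_qmul -pi_quotD mulrDl.
Qed.

HB.instance Definition _ :=
  GRing.Zmodule_isComPzRing.Build Q qmulA qmulC qmul1 qmulDl.

End IdealQuotient.

Record simplicial_complex (V : finType) := SimplicialComplex {
  faces :> {set {set V}};
  face_set0 : set0 \in faces;
  face_set1 : forall v : V, [set v] \in faces;
  face_sub : forall A B : {set V}, A \subset B -> B \in faces -> A \in faces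
}.

Section StanleyReisner.
Variables (R : comPzRingType) (V : finType) (D : simplicial_complex V).

Definition sr_generator (g : polynomial_algebra R V) : Prop :=
  exists2 A : {set V}, A \notin faces D & g = \prod_(v in A) pvar R v.

Definition sr_algebra : Type := ideal_quotient sr_generator.
HB.instance Definition _ := EqQuotient.on sr_algebra.
HB.instance Definition _ := GRing.ComPzRing.on sr_algebra.

Definition sr_scale (c : R) := lift_op1 sr_algebra ( *:%R c).

Fact pi_sr_scale c p : sr_scale c (\pi_sr_algebra p) = \pi_sr_algebra (c *: p).
Proof.
unlock sr_scale; apply/eqP; rewrite eq_ideal_quotient -scalerBr.
rewrite -[_ - p]mul1r pscalerAl; apply: generated_idealM.
by rewrite -eq_ideal_quotient reprK.
Qed.

Fact sr_scaleA c d x : sr_scale c (sr_scale d x) = sr_scale (c * d) x.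
Proof. by rewrite -(reprK x) !pi_sr_scale scalerA. Qed.
Fact sr_scale1 : left_id 1 sr_scale.
Proof. by move=> x; rewrite -(reprK x) pi_sr_scale scale1r. Qed.
Fact sr_scaleDr : right_distributive sr_scale +%R.
Proof.
move=> c x y; rewrite -(reprK x) -(reprK y).
by rewrite -pi_quotD !pi_sr_scale -pi_quotD scalerDr.
Qed.
Fact sr_scaleDl x : {morph sr_scale^~ x : c d / c + d}.
Proof.
by move=> c d; rewrite -(reprK x) !pi_sr_scale -pi_quotD scalerDl.
Qed.

HB.instance Definition _ := GRing.Zmodule_isLmodule.Build R sr_algebra
  sr_scaleA sr_scale1 sr_scaleDr sr_scaleDl.

Fact sr_scalerAl (c : R) (x y : sr_algebra) : c *: (x * y) = (c *: x) * y.
Proof.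
rewrite -(reprK x) -(reprK y); set p := repr x; set q := repr y.
have -> : c *: (\pi_sr_algebra p : sr_algebra) = \pi_sr_algebra (c *: p).
  exact: pi_sr_scale.
have pi_mul r : (\pi_sr_algebra r : sr_algebra) * \pi_sr_algebra q =
    \pi_sr_algebra (r * q) by exact: pi_qmul.
by rewrite !pi_mul -pscalerAl; exact: pi_sr_scale.
Qed.

End StanleyReisner.

Section FreeBinoid.
Variable V : finType.

(* None is the absorbing element; Some f is the element \sum_v (f v) v. *)
Definition free_binoid : Type := option {ffun V -> nat}.
HB.instance Definition _ := Choice.on free_binoid.

Implicit Types a b : free_binoid.

Definition fb_add a b : free_binoid :=
  if a is Some f then
    if b is Some g then Some [ffun v => f v + g v]%N else None
  else None.

Fact fb_addA : associative fb_add.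
Proof.
case=> [f|] [g|] [h|] //=; congr Some.
by apply/ffunP => v; rewrite !ffunE addnA.
Qed.
Fact fb_addC : commutative fb_add.
Proof.
by case=> [f|] [g|] //=; congr Some; apply/ffunP => v; rewrite !ffunE addnC.
Qed.
Fact fb_add0 : left_id (Some [ffun=> 0%N]) fb_add.
Proof. by case=> [f|] //=; congr Some; apply/ffunP => v; rewrite !ffunE. Qed.

HB.instance Definition _ :=
  GRing.isNmodule.Build free_binoid fb_addA fb_addC fb_add0.

Fact fb_addinf a : a + (None : free_binoid) = (None : free_binoid).
Proof. by case: a. Qed.

HB.instance Definition _ := Nmodule_isBinoid.Build free_binoid fb_addinf.

Definition supp (f : {ffun V -> nat}) : {set V} := [set v | f v != 0%N].

End FreeBinoid.

Section ComplexBinoid.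
Variables (V : finType) (D : simplicial_complex V).

Definition sc_null (a : free_binoid V) : bool :=
  if a is Some f then supp f \notin faces D else true.

Definition sc_rel (a b : free_binoid V) : bool :=
  (a == b) || (sc_null a && sc_null b).

Fact sc_rel_equiv : equiv_class_of sc_rel.
Proof.
split=> [a|a b|b a c]; rewrite /sc_rel ?eqxx //.
  by rewrite eq_sym andbC.
case/orP=> [/eqP->|/andP[na nb]] // /orP[/eqP<-|/andP[_ nc]].
  by rewrite na nb orbT.
by rewrite na nc orbT.
Qed.

Canonical sc_equiv := EquivRelPack sc_rel_equiv.
Canonical sc_encModRel := defaultEncModRel sc_rel.

Definition sc_binoid : Type := {eq_quot sc_rel}.
HB.instance Definition _ : EqQuotient _ sc_rel sc_binoid :=
  EqQuotient.on sc_binoid.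
HB.instance Definition _ := Choice.on sc_binoid.

Local Notation M := sc_binoid.

Fact sc_eq (a b : free_binoid V) : (\pi_M a == \pi_M b) = sc_rel a b.
Proof. exact: piE. Qed.

Fact sc_nullD a b : sc_null a -> sc_null (a + b).
Proof.
case: a b => [f|] [g|] //=; apply: contra; apply: face_sub.
by apply/subsetP => v; rewrite !inE ffunE addn_eq0 negb_and => ->.
Qed.

Definition sc_add := lift_op2 M +%R.

Fact pi_sc_add a b : sc_add (\pi_M a) (\pi_M b) = \pi_M (a + b).
Proof.
have sc_relD c d d' : sc_rel d d' -> sc_rel (c + d) (c + d').
  rewrite /sc_rel => /orP[/eqP->|/andP[nd nd']]; first by rewrite eqxx.
  by rewrite ![c + _]addrC !sc_nullD ?orbT.
have repr_rel c : sc_rel (repr (\pi_M c)) c by rewrite -sc_eq reprK.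
unlock sc_add; apply/eqP; rewrite sc_eq.
apply: (@equiv_trans _ _ (repr (\pi_M a) + b)); first exact: sc_relD.
by rewrite ![_ + b]addrC; apply: sc_relD.
Qed.

Fact sc_addA : associative sc_add.
Proof.
by move=> x y z; rewrite -(reprK x) -(reprK y) -(reprK z) !pi_sc_add addrA.
Qed.
Fact sc_addC : commutative sc_add.
Proof. by move=> x y; rewrite -(reprK x) -(reprK y) !pi_sc_add addrC. Qed.
Fact sc_add0 : left_id (\pi_M 0) sc_add.
Proof. by move=> x; rewrite -(reprK x) pi_sc_add add0r. Qed.

HB.instance Definition _ := GRing.isNmodule.Build M sc_addA sc_addC sc_add0.

Fact sc_addinf (x : M) : x + \pi_M binfty = \pi_M binfty.
Proof. by rewrite -(reprK x) [LHS]pi_sc_add addr_binfty. Qed.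

HB.instance Definition _ := Nmodule_isBinoid.Build M sc_addinf.

End ComplexBinoid.

(* Main.v *)
Require Import Defs.
From HB Require Import structures.
From mathcomp Require Import all_boot all_algebra.
From mathcomp Require Import finmap boolp monalg.

(** Send the monomial [X^m] to [T^[m]], where [[m]] is the class of [m] in
    [M_Delta], read as zero when [[m] = infty].  A monomial dies exactly when
    its support is not a face, and distinct surviving monomials have distinct
    images.  Lifting each [T^a] to the unique monomial representing [a] gives a
    section [G] of this algebra map [F], and [p - G (F p)] is a combination of
    monomials with non-face support, each of them a multiple of a generator of
    the Stanley-Reisner ideal.  So the kernel of [F] is that ideal. *)

Set Implicit Arguments.
Unset Strict Implicit.
Unset Printing Implicit Defensive.

Import GRing.Theory.
Local Open Scope ring_scope.
Local Open Scope quotient_scope.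

(** * Additive maps out of finitely supported functions *)

Section AdditiveExtension.
Variables (R : zmodType) (K : choiceType) (W : zmodType) (T : K -> R -> W).
Hypothesis TB : forall k, {morph T k : c d / c - d}.

Definition malg_ext (g : {malg R[K]}) : W := \sum_(k <- msupp g) T k g@_k.

Let T0 k : T k 0 = 0.
Proof. by rewrite -[X in T k X](subrr 0) TB subrr. Qed.

(** Coefficients outside the support contribute [T k 0 = 0], so the sum may run over any larger
    finite set, such as one common to [g], [h] and [g - h]. *)
Lemma malg_extEw (d : {fset K}) (g : {malg R[K]}) :
  (msupp g `<=` d)%fset -> malg_ext g = \sum_(k <- d) T k g@_k.
Proof.
move=> le; rewrite /malg_ext (big_fset_incl _ le) //= => k _ /mcoeff_outdom ->.
exact: T0.
Qed.

Lemma malg_ext_is_zmod_morphism : zmod_morphism malg_ext.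
Proof.
move=> g h; rewrite (malg_extEw (msuppB_le g h)).
rewrite (malg_extEw (fsubsetUl (msupp g) (msupp h))).
rewrite (malg_extEw (fsubsetUr (msupp g) (msupp h))) -sumrB.
by apply: eq_bigr => k _; rewrite mcoeffB TB.
Qed.

Lemma malg_extU c k : malg_ext << c *g k >> = T k c.
Proof. by rewrite (malg_extEw msuppU_le) big_seq_fset1 mcoeffUU. Qed.

End AdditiveExtension.

Lemma malg_pzscaleU (R : comPzRingType) (K : choiceType) (c d : R) (k : K) :
  malg_pzscale c << d *g k >> = << c * d *g k >>.
Proof. by apply/malgP => j; rewrite mcoeff_pzscale !mcoeffU mulrnAr. Qed.

(** * Arithmetic of the terms $c T^a$ *)

Section BinoidTerms.
Variables (R : comPzRingType) (M : binoidType).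

Lemma bterm_binfty (c : R) : bterm (@binfty M) c = 0.
Proof. by rewrite /bterm insubF ?eqxx. Qed.

Lemma bterm0 (a : M) : bterm a (0 : R) = 0.
Proof. by rewrite -[X in bterm a X](subrr 0) btermB subrr. Qed.

Lemma btermM (a b : M) (c d : R) : bterm a c * bterm b d = bterm (a + b) (c * d).
Proof.
have [->|bn] := eqVneq b binfty.
  by rewrite addr_binfty !bterm_binfty mulr0.
pose k : {a : M | a != binfty} := exist _ b bn.
rewrite -[b]/(val k) bterm_val.
rewrite [LHS](convolution_Tg (@addrC M) (@add0r M) (@btermB R M)
  (@bterm_val R M) (@bterm_dich R M)).
(* For [d = 0] the support of [<< d *g k >>] is empty instead of the singleton of [k]. *)
rewrite msuppU; case: eqP => [->|_]; last by rewrite big_seq_fset1 mcoeffUU.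
by rewrite big_seq_fset0 mulr0 bterm0.
Qed.

Lemma bterm_scale (c : R) (a : M) (d : R) : c *: bterm a d = bterm a (c * d).
Proof.
by rewrite /bterm; case: insubP => [k _ _|_]; [exact: malg_pzscaleU|exact: scaler0].
Qed.

End BinoidTerms.

(** * Monomials as exponent functions *)

Section Monomials.
Variables (R : comPzRingType) (V : finType).

Definition ffun_monom (f : {ffun V -> nat}) : {cmonom V} :=
  [cmonom f v | v in [fset v in V]]%M.

Lemma ffun_monomE f v : ffun_monom f v = f v.
Proof. by rewrite /ffun_monom cmE fsfun_fun !inE. Qed.

Definition monom_ffun (m : {cmonom V}) : {ffun V -> nat} := [ffun v => m v].

Lemma monom_ffunK : cancel monom_ffun ffun_monom.
Proof. by move=> m; apply/eqP/cmP => v; rewrite ffun_monomE ffunE. Qed.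

Lemma ffun_monomK : cancel ffun_monom monom_ffun.
Proof. by move=> f; apply/ffunP => v; rewrite ffunE ffun_monomE. Qed.

Lemma pmulUU (m n : {cmonom V}) (c d : R) :
  (<< c *g m >> : polynomial_algebra R V) * << d *g n >> = << c * d *g mmul m n >>.
Proof.
pose U (k : {cmonom V}) (x : R) : {malg R[{cmonom V}]} := << x *g k >>.
rewrite [LHS](@convolutionEw R _ _ mmul id U (@monalgUB _ R) _ _ _ _
  msuppU_le msuppU_le).
by rewrite !big_seq_fset1 !mcoeffUU.
Qed.

Lemma prod_pvarE (A : {set V}) :
  \prod_(v in A) pvar R v = << ffun_monom [ffun v => (v \in A) : nat] >>.
Proof.
have -> : \prod_(v in A) pvar R v =
    << \big[mmul/mone]_(v in A) ucm v >> :> polynomial_algebra R V.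
  elim/big_rec2: _ => [//|v m p _ ->].
  by rewrite pmulUU mulr1.
congr << _ >>; apply/eqP/cmP => u; rewrite ffun_monomE ffunE.
(* The exponent of [u] counts the [v] in [A] equal to [u]. *)
have -> : (\big[mmul/mone]_(v in A) ucm v) u = (\sum_(v in A) (v == u))%N.
  by elim/big_rec2: _ => [|v n m _ <-]; rewrite ?cm1 ?cmM ?cmU.
have [uA|uA] := boolP (u \in A).
  rewrite (bigD1 u) //= eqxx big1 ?addn0 // => v /andP[_ /negPf->] //.
by rewrite big1 // => v vA; case: eqP vA uA => // -> ->.
Qed.

End Monomials.

(** * Monomials and their classes in $M_\Delta$ *)

Section StanleyReisnerIso.
Variables (V : finType) (D : simplicial_complex V) (R : comPzRingType).
Local Notation M := (sc_binoid D).
Local Notation P := (polynomial_algebra R V).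
Local Notation B := (binoid_algebra R M).
Local Notation I := (generated_idealb (@sr_generator R V D)).

Definition monom_class (m : {cmonom V}) : M := \pi_M (Some (monom_ffun m)).

Lemma monom_classM m n : monom_class (mmul m n) = monom_class m + monom_class n.
Proof.
rewrite [RHS]pi_sc_add; congr (\pi_M (Some _)).
by apply/ffunP => v; rewrite !ffunE cmM.
Qed.

Lemma monom_class1 : monom_class mone = 0.
Proof.
by rewrite /monom_class; congr (\pi_M (Some _)); apply/ffunP => v; rewrite !ffunE cm1.
Qed.

(** [binfty] is the class of [None], which [sc_rel] relates exactly to the null elements. *)
Lemma monom_class_binfty m :
  (monom_class m == binfty) = (supp (monom_ffun m) \notin faces D).
Proof. by rewrite [LHS]sc_eq /sc_rel /= andbT. Qed.

(** Inverse of [monom_class] away from [binfty]. Since [repr x] can be [None] only for [x = binfty],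
    the value [mone] is a mere default. *)
Definition class_monom (x : M) : {cmonom V} :=
  if repr x is Some f then ffun_monom f else mone.

Lemma class_monomK x : x != binfty -> monom_class (class_monom x) = x.
Proof.
rewrite /class_monom -{1 3}[x]reprK.
by case: (repr x) => [f|] xn; [rewrite /monom_class ffun_monomK|case/eqP: xn].
Qed.

(** A class other than [binfty] has a single representative: [sc_rel] identifies distinct elements
    only when both are null. *)
Lemma monom_classK m : monom_class m != binfty -> class_monom (monom_class m) = m.
Proof.
move=> mn; have := class_monomK mn; move/eqP; rewrite [_ == _]sc_eq.
rewrite monom_class_binfty negbK in mn.
by rewrite /sc_rel /= mn /= andbF orbF => /eqP[/(can_inj (@monom_ffunK V))].
Qed.

Lemma sr_ideal_monom (m : {cmonom V}) (c : R) :
  supp (monom_ffun m) \notin faces D -> (<< c *g m >> : P) \in I.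
Proof.
set A := supp _ => AD.
(* Exponents on the support [A] of [m] drop by 1. They are positive there, so the subtraction does
   not truncate and [m] is [n] times the squarefree monomial of [A]. *)
pose n := ffun_monom [ffun v => (m v - (v \in A))%N].
have mE : mmul n (ffun_monom [ffun v => (v \in A) : nat]) = m.
  apply/eqP/cmP => v.
  by rewrite cmM !ffun_monomE !ffunE subnK // inE ffunE; case: (m v).
have -> : (<< c *g m >> : P) = (<< c *g n >> : P) * \prod_(v in A) pvar R v.
  by rewrite prod_pvarE pmulUU mulr1 mE.
apply: generated_idealM; apply/asboolP.
exists [:: (1, \prod_(v in A) pvar R v)]; last by rewrite big_seq1 mul1r.
by move=> _ /[1!inE] /eqP-> /=; exists A.
Qed.

(** * The evaluation map and its additive section *)

Definition sr_eval (p : P) : B := malg_ext (fun m => bterm (monom_class m)) p.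

(** Additive but in general not multiplicative: if two classes add up to [binfty], the product of
    their lifts is a monomial of the ideal rather than 0. *)
Definition sr_lift (x : B) : P :=
  malg_ext (fun k c => << c *g class_monom (val k) >> : P) x.

HB.instance Definition _ := GRing.isZmodMorphism.Build P B sr_eval
  (malg_ext_is_zmod_morphism (fun m => @btermB R M (monom_class m))).

HB.instance Definition _ := GRing.isZmodMorphism.Build B P sr_lift
  (malg_ext_is_zmod_morphism
     (fun k : {a : M | a != binfty} => @monalgUB _ R (class_monom (val k)))).

Lemma sr_evalU c m : sr_eval << c *g m >> = bterm (monom_class m) c.
Proof. exact: (malg_extU (fun m => @btermB R M (monom_class m))). Qed.

Lemma sr_liftU c (k : {a : M | a != binfty}) :
  sr_lift << c *g k >> = << c *g class_monom (val k) >>.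
Proof.
exact: (malg_extU
  (fun k : {a : M | a != binfty} => @monalgUB _ R (class_monom (val k)))).
Qed.

Lemma sr_evalE p :
  sr_eval p = \sum_(m <- msupp p) bterm (monom_class m) p@_m.
Proof. by []. Qed.

Lemma sr_eval_is_monoid_morphism : monoid_morphism sr_eval.
Proof.
split=> [|p q]; first by rewrite [sr_eval _]sr_evalU monom_class1.
rewrite -[p * q]/(pmul p q) /pmul raddf_sum /= [sr_eval p]sr_evalE mulr_suml.
apply: eq_bigr => m _; rewrite raddf_sum /= [sr_eval q]sr_evalE mulr_sumr.
by apply: eq_bigr => n _; rewrite sr_evalU btermM monom_classM.
Qed.

HB.instance Definition _ := GRing.isMonoidMorphism.Build P B sr_eval
  sr_eval_is_monoid_morphism.

Lemma sr_evalZ : scalable sr_eval.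
Proof.
move=> c p; rewrite [p in LHS](monalgE p) scaler_sumr raddf_sum /=.
rewrite [sr_eval p]sr_evalE scaler_sumr; apply: eq_bigr => m _.
by rewrite [_ *: _]malg_pzscaleU sr_evalU bterm_scale.
Qed.

(** Each generator is a squarefree monomial whose support is a non-face [A], so its class is
    [binfty] and [sr_eval] kills all its multiples. *)
Lemma sr_eval_ideal p : p \in I -> sr_eval p = 0.
Proof.
move=> /asboolP[s sS ->]; rewrite raddf_sum big_seq big1 // => ag /sS[A AD gE].
rewrite /= rmorphM /= gE prod_pvarE sr_evalU.
set m := ffun_monom _; have /eqP-> : monom_class m == binfty.
  have suppA : supp [ffun v => (v \in A) : nat] = A.
    by apply/setP => v; rewrite inE ffunE; case: (v \in A).
  by rewrite monom_class_binfty ffun_monomK suppA.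
by rewrite bterm_binfty mulr0.
Qed.

Lemma sr_liftK : cancel sr_lift sr_eval.
Proof.
move=> x; rewrite raddf_sum /= [RHS](monalgE x).
apply: eq_bigr => k _; rewrite sr_evalU class_monomK ?(valP k) //.
exact: bterm_val.
Qed.

Lemma sr_evalK (p : P) : p - sr_lift (sr_eval p) \in I.
Proof.
have pE : p = \sum_(m <- msupp p) (<< p@_m *g m >> : P) := monalgE p.
rewrite {1}pE sr_evalE [sr_lift _]raddf_sum -sumrB; apply: rpred_sum => m _ /=.
(* A monomial of class [binfty] lies in the ideal itself; any other is recovered exactly by
   [sr_lift]. *)
have [mi|mn] := eqVneq (monom_class m) binfty.
  rewrite mi bterm_binfty raddf0 subr0; apply: sr_ideal_monom.
  by rewrite -monom_class_binfty mi.
pose k : {a : M | a != binfty} := Sub (monom_class m) mn.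
by rewrite -[monom_class m]/(val k) bterm_val sr_liftU monom_classK // subrr rpred0.
Qed.

(** * The induced map on the quotient *)

Definition sr_map (x : sr_algebra R D) : B := sr_eval (repr x).

(** The chosen representative differs from [p] by an element of the ideal, which [sr_eval] kills. *)
Lemma sr_map_pi p : sr_map (\pi_(sr_algebra R D) p) = sr_eval p.
Proof.
apply/eqP; rewrite -subr_eq0 -raddfB; apply/eqP/sr_eval_ideal.
by rewrite -eq_ideal_quotient reprK.
Qed.

Lemma sr_map_is_zmod_morphism : zmod_morphism sr_map.
Proof.
move=> x y; rewrite -{1 2}[x]reprK -{1 2}[y]reprK.
have -> : (\pi_(sr_algebra R D) (repr x) : sr_algebra R D) -
    \pi_(sr_algebra R D) (repr y) = \pi_(sr_algebra R D) (repr x - repr y).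
  apply/eqP; rewrite subr_eq; apply/eqP.
  by rewrite -[RHS]pi_quotD addrNK.
by rewrite !sr_map_pi raddfB.
Qed.

Lemma sr_map_is_monoid_morphism : monoid_morphism sr_map.
Proof.
split=> [|x y]; first by rewrite [sr_map _]sr_map_pi rmorph1.
by rewrite -[x]reprK -[y]reprK [_ * _]pi_qmul !sr_map_pi rmorphM.
Qed.

HB.instance Definition _ :=
  GRing.isZmodMorphism.Build (sr_algebra R D) B sr_map sr_map_is_zmod_morphism.
HB.instance Definition _ :=
  GRing.isMonoidMorphism.Build (sr_algebra R D) B sr_map
    sr_map_is_monoid_morphism.

Lemma sr_mapZ : scalable sr_map.
Proof.
by move=> c x; rewrite -[x]reprK [_ *: _]pi_sr_scale !sr_map_pi sr_evalZ.
Qed.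

Lemma sr_map_bij : bijective sr_map.
Proof.
(* The inverse is [sr_lift] followed by projection: [sr_evalK] gives one composite modulo the ideal,
   [sr_liftK] the other. *)
exists (fun x => \pi_(sr_algebra R D) (sr_lift x)) => [x|x].
  rewrite -{2}[x]reprK; apply/eqP.
  by rewrite eq_sym eq_ideal_quotient sr_evalK.
by rewrite sr_map_pi sr_liftK.
Qed.

End StanleyReisnerIso.

Theorem lemma6p5p7 (V : finType) (D : simplicial_complex V)
    (R : comPzRingType) :
  exists f : {rmorphism sr_algebra R D -> binoid_algebra R (sc_binoid D)},
    scalable f /\ bijective f.
Proof.
by exists (@sr_map V D R); split; [exact: sr_mapZ|exact: sr_map_bij].
Qed.
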